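(* Let $\mathsf{C}$ be a strict braided monoidal category and let $(\pi:B\to H,\theta_\pi)$ be a generalized invertible 1-cocycle in $\mathsf{C}$ with action $\phi_H:B\otimes H\to H$. Let $\mathbb{H}_\pi=(H,H_\pi,\sigma_\pi)$ be the associated Hopf truss, where $H_\pi=(H,\mu_H^\pi,\varepsilon_H,\delta_H)$, $\mu_H^\pi=\pi\circ\mu_B\circ(\pi^{-1}\otimes\pi^{-1})$ and $\sigma_\pi=\pi\circ\theta_\pi\circ\pi^{-1}$. Then the category ${}_{(\pi,\phi_H,\theta_\pi)}\mathsf{Mod}$ of left modules over $(\pi:B\to H,\theta_\pi)$ and the category ${}_{\mathbb{H}_\pi}\mathsf{Mod}$ of left $\mathbb{H}_\pi$-modules are equivalent.
   Context: **Conventions.** $(\mathsf{C},\otimes,K,c)$ is a strict braided monoidal category with unit object $K$ and braiding $c$. For an object $P$ and a morphism $f$, $P\otimes f$ and $f\otimes P$ mean $id_P\otimes f$ and $f\otimes id_P$. Monoids $(A,\eta_A,\mu_A)$ (unit, product) and comonoids $(D,\varepsilon_D,\delta_D)$ (counit, coproduct) and their morphisms are the usual (co)associative (co)unital ones. For comonoids $D,E$, $D\otimes E$ is a comonoid with $\varepsilon_{D\otimes E}=\varepsilon_D\otimes\varepsilon_E$, $\delta_{D\otimes E}=(D\otimes c_{D,E}\otimes E)\circ(\delta_D\otimes\delta_E)$. Left modules over a monoid are the usual unital ones. **Bimonoids, Hopf monoids.** A non-unital bimonoid is a comonoid $(B,\varepsilon_B,\delta_B)$ with an associative product $\mu_B:B\otimes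 B\to B$ (no unit required) that is a comonoid morphism; morphisms of non-unital bimonoids are multiplicative comonoid morphisms. A bimonoid is an object that is a monoid and a comonoid such that unit and product are comonoid morphisms; a Hopf monoid is a bimonoid $H$ with an antipode $\lambda_H:H\to H$, i.e. $\mu_H\circ(H\otimes\lambda_H)\circ\delta_H=\eta_H\circ\varepsilon_H=\mu_H\circ(\lambda_H\otimes H)\circ\delta_H$. **Hopf trusses.** A Hopf truss $\mathbb{H}=(H_1,H_2,\sigma_H)$ in $\mathsf{C}$ consists of a comonoid $(H,\varepsilon_H,\delta_H)$ together with $\eta_H,\mu_H^1,\mu_H^2,\lambda_H,\sigma_H$ such that $H_1=(H,\eta_H,\mu_H^1,\varepsilon_H,\delta_H,\lambda_H)$ is a Hopf monoid, $H_2=(H,\mu_H^2,\varepsilon_H,\delta_H)$ is a non-unital bimonoid, $\sigma_H:H\to H$ is a comonoid morphism, and $$\mu_H^2\circ(H\otimes\mu_H^1)=\mu_H^1\circ(\mu_H^2\otimes\Gamma_{H_1}^{\sigma_H})\circ(H\otimes c_{H,H}\otimes H)\circ(\delta_H\otimes H\otimes H),$$ where $\Gamma_{H_1}^{\sigma_H}=\mu_H^1\circ((\lambda_H\circ\sigma_H)\otimes\mu_H^2)\circ(\delta_H\otimes H)$. **Non-unital module monoids.** For a non-unital bimonoid $B$, a non-unital left $B$-module is a pair $(M,\phi_M)$ with $\phi_M:B\otimes M\to M$ satisfying $\phi_M\circ(B\otimes\phi_M)=\phi_M\circ(\mu_B\otimes M)$. A monoid $A$ with $\phi_A:B\otimes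 A\to A$ is a non-unital left $B$-module monoid if $(A,\phi_A)$ is a non-unital left $B$-module, $\phi_A\circ(B\otimes\eta_A)=\varepsilon_B\otimes\eta_A$, and $\phi_A\circ(B\otimes\mu_A)=\mu_A\circ(\phi_A\otimes\phi_A)\circ(B\otimes c_{B,A}\otimes A)\circ(\delta_B\otimes A\otimes A)$. **Generalized invertible 1-cocycles.** Let $H$ be a Hopf monoid, $B$ a non-unital bimonoid, and suppose $H$ is a non-unital left $B$-module monoid with action $\phi_H$. A comonoid morphism $\pi:B\to H$ is a generalized invertible 1-cocycle if it is an isomorphism and there is a comonoid endomorphism $\theta_\pi:B\to B$ with $$\pi\circ\mu_B=\mu_H\circ((\pi\circ\theta_\pi)\otimes\phi_H)\circ(\delta_B\otimes\pi).$$ It is denoted $(\pi:B\to H,\theta_\pi)$. The data $\mathbb{H}_\pi$ of the claim is then a Hopf truss. **Modules over a Hopf truss.** A left $\mathbb{H}$-module is a triple $(M,\psi_M^1,\psi_M^2)$ where $(M,\psi_M^1)$ is a left $H_1$-module, $(M,\psi_M^2)$ is a non-unital left $H_2$-module and $$\psi_M^2\circ(H\otimes\psi_M^1)=\psi_M^1\circ(\mu_H^2\otimes\Gamma_M^{\sigma_H})\circ(H\otimes c_{H,H}\otimes M)\circ(\delta_H\otimes H\otimes M),$$ with $\Gamma_M^{\sigma_H}=\psi_M^1\circ((\lambda_H\circ\sigma_H)\otimes\psi_M^2)\circ(\delta_H\otimes M)$. Morphisms are morphisms of $\mathsf{C}$ that are linear for both actions. The category is ${}_{\mathbb{H}}\mathsf{Mod}$.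 **Modules over a generalized invertible 1-cocycle.** A left module over $(\pi:B\to H,\theta_\pi)$ is a 6-tuple $(M,N,\phi_M,\varphi_M,\phi_N,\gamma)$ where: (i) $\phi_M:B\otimes M\to M$ is a morphism in $\mathsf{C}$; (ii) $(M,\varphi_M)$ is a left $H$-module; (iii) $(N,\phi_N)$ is a non-unital left $B$-module; (iv) $\phi_M\circ(B\otimes\varphi_M)=\varphi_M\circ(\phi_H\otimes\phi_M)\circ(B\otimes c_{B,H}\otimes M)\circ(\delta_B\otimes H\otimes M)$; (v) $\gamma:N\to M$ is an isomorphism in $\mathsf{C}$ with $\gamma\circ\phi_N=\varphi_M\circ((\pi\circ\theta_\pi)\otimes\phi_M)\circ(\delta_B\otimes\gamma)$. A morphism to $(M',N',\phi_{M'},\varphi_{M'},\phi_{N'},\gamma')$ is a pair $(h,l)$ of morphisms $h:M\to M'$, $l:N\to N'$ in $\mathsf{C}$ with $h\circ\phi_M=\phi_{M'}\circ(B\otimes h)$, $h$ left $H$-linear, $l$ left $B$-linear, and $h\circ\gamma=\gamma'\circ l$. The category is ${}_{(\pi,\phi_H,\theta_\pi)}\mathsf{Mod}$. *)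

(* Defs.v *)
From Corelib Require Import ssreflect ssrbool.
From Stdlib Require Import ProofIrrelevance.

Set Implicit Arguments.
Unset Strict Implicit.
Unset Printing Implicit Defensive.

Record category := Category {
  ob :> Type;
  hom : ob -> ob -> Type;
  idm : forall A : ob, hom A A;
  comp : forall A B C : ob, hom B C -> hom A B -> hom A C;
  compA : forall A B C D (h : hom C D) (g : hom B C) (f : hom A B),
    comp h (comp g f) = comp (comp h g) f;
  comp1m : forall A B (f : hom A B), comp (idm B) f = f;
  compm1 : forall A B (f : hom A B), comp f (idm A) = f }.

Arguments hom {c} A B.
Arguments idm {c} A.
Arguments comp {c A B C} g f.
Arguments compA {c A B C D} h g f.
Arguments comp1m {c A B} f.
Arguments compm1 {c A B} f.

Notation "g ∘ f" := (comp g f) (at level 40, left associativity).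

(* The inverse is unique, so recording it as data is harmless; it gives a
   name to π^{-1} and γ^{-1}. *)
Record iso (C : category) (A B : C) := Iso {
  fwd :> hom A B;
  inv : hom B A;
  invK : inv ∘ fwd = idm A;
  fwdK : fwd ∘ inv = idm B }.

Definition is_iso (C : category) (A B : C) (f : hom A B) : Prop :=
  exists g : hom B A, g ∘ f = idm A /\ f ∘ g = idm B.

Record functor (C D : category) := Functor {
  fob :> C -> D;
  fmap : forall A B : C, hom A B -> hom (fob A) (fob B);
  fmap1 : forall A, fmap (idm A) = idm (fob A);
  fmapM : forall A B X (g : hom B X) (f : hom A B),
    fmap (g ∘ f) = fmap g ∘ fmap f }.

Definition functor_id (C : category) : functor C C :=
  @Functor C C (fun A => A) (fun A B f => f)
    (fun A => eq_refl) (fun A B X g f => eq_refl).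

Lemma functor_comp1 (C D E : category) (G : functor D E) (F : functor C D) A :
  fmap G (fmap F (idm A)) = idm (G (F A)).
Proof. by rewrite !fmap1. Qed.

Lemma functor_compM (C D E : category) (G : functor D E) (F : functor C D)
  (A B X : C) (g : hom B X) (f : hom A B) :
  fmap G (fmap F (g ∘ f)) = fmap G (fmap F g) ∘ fmap G (fmap F f).
Proof. by rewrite !fmapM. Qed.

Definition functor_comp (C D E : category) (G : functor D E) (F : functor C D) :
  functor C E :=
  @Functor C E (fun A => G (F A)) (fun A B f => fmap G (fmap F f))
    (functor_comp1 G F) (functor_compM G F).

Definition nat_isomorphic (C D : category) (F G : functor C D) : Prop :=
  exists a : forall X : C, hom (F X) (G X),
    (forall X, is_iso (a X)) /\
    (forall (X Y : C) (f : hom X Y), a Y ∘ fmap F f = fmap G f ∘ a X).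

Definition equivalent (C D : category) : Prop :=
  exists (F : functor C D) (G : functor D C),
    nat_isomorphic (functor_comp G F) (functor_id C) /\
    nat_isomorphic (functor_comp F G) (functor_id D).

(* The identity morphism, read as a morphism between two equal objects.  In a
   strict monoidal category (A ⊗ B) ⊗ C and A ⊗ (B ⊗ C) are equal, but not
   convertible; an equality of morphisms that is well-typed only up to such
   equalities of objects is stated by inserting these identities.           *)
Definition idto (C : category) (A B : C) (e : A = B) : hom A B :=
  match e with eq_refl => idm A end.

Section Heq.
Variable C : category.

Definition heq (A B A' B' : C) (f : hom A B) (g : hom A' B') : Prop :=
  exists (p : A = A') (q : B = B'), idto q ∘ f = g ∘ idto p.

Lemma heq_refl (A B : C) (f : hom A B) : heq f f.
Proof. by exists eq_refl, eq_refl; rewrite /= comp1m compm1. Qed.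

Lemma eq_heq (A B : C) (f g : hom A B) : f = g -> heq f g.
Proof. by move=> ->; exact: heq_refl. Qed.

Lemma heq_eq (A B : C) (f g : hom A B) : heq f g -> f = g.
Proof.
move=> [p [q]]; rewrite (proof_irrelevance _ p eq_refl).
by rewrite (proof_irrelevance _ q eq_refl) /= comp1m compm1.
Qed.

Lemma heq_sym (A B A' B' : C) (f : hom A B) (g : hom A' B') :
  heq f g -> heq g f.
Proof.
move=> [p [q]]; case: _ / p g q => g q; case: _ / q g => g /=.
by rewrite comp1m compm1 => ->; exact: heq_refl.
Qed.

Lemma heq_trans (A B A' B' A'' B'' : C) (g : hom A' B') (f : hom A B)
  (h : hom A'' B'') : heq f g -> heq g h -> heq f h.
Proof.
move=> [p [q]]; case: _ / p g q => g q; case: _ / q g => g /=.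
by rewrite comp1m compm1 => ->.
Qed.

Lemma heq_comp (A B X A' B' X' : C) (g : hom B X) (f : hom A B)
  (g' : hom B' X') (f' : hom A' B') :
  heq g g' -> heq f f' -> heq (g ∘ f) (g' ∘ f').
Proof.
move=> [p [q Eg]] [r [s Ef]].
case: _ / p g' f' s Eg Ef => g' f' s.
rewrite (proof_irrelevance _ s eq_refl).
case: _ / q g' => g'; case: _ / r f' => f' /=.
by rewrite !comp1m !compm1 => -> ->; exact: heq_refl.
Qed.

Lemma heq_idtoL (A B X : C) (e : B = X) (f : hom A B) : heq (idto e ∘ f) f.
Proof. by case: _ / e => /=; rewrite comp1m; exact: heq_refl. Qed.

Lemma heq_idtoR (A B X : C) (e : X = A) (f : hom A B) : heq (f ∘ idto e) f.
Proof. by case: A / e f => f /=; rewrite compm1; exact: heq_refl. Qed.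

End Heq.

Reserved Notation "A ⊗ B" (at level 30, right associativity).
Reserved Notation "f ⊠ g" (at level 30, right associativity).

Record strict_monoidal := StrictMonoidal {
  mcat :> category;
  tens : mcat -> mcat -> mcat
    where "A ⊗ B" := (tens A B);
  K : mcat;
  tensm : forall A B A' B' : mcat,
    hom A B -> hom A' B' -> hom (A ⊗ A') (B ⊗ B')
    where "f ⊠ g" := (tensm f g);
  tensm_id : forall A B, idm A ⊠ idm B = idm (A ⊗ B);
  tensm_comp : forall A B X A' B' X'
    (g : hom B X) (f : hom A B) (g' : hom B' X') (f' : hom A' B'),
    (g ∘ f) ⊠ (g' ∘ f') = (g ⊠ g') ∘ (f ⊠ f');
  tensA : forall A B X, (A ⊗ B) ⊗ X = A ⊗ (B ⊗ X);
  tens1o : forall A, K ⊗ A = A;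
  tenso1 : forall A, A ⊗ K = A;
  tensmA : forall A B X A' B' X' (f : hom A A') (g : hom B B') (h : hom X X'),
    idto (tensA A' B' X') ∘ ((f ⊠ g) ⊠ h) = (f ⊠ (g ⊠ h)) ∘ idto (tensA A B X);
  tens1m : forall A A' (f : hom A A'),
    idto (tens1o A') ∘ (idm K ⊠ f) = f ∘ idto (tens1o A);
  tensm1 : forall A A' (f : hom A A'),
    idto (tenso1 A') ∘ (f ⊠ idm K) = f ∘ idto (tenso1 A) }.

Arguments tens {s} A B.
Arguments K {s}.
Arguments tensm {s A B A' B'} f g.
Arguments tensA {s} A B X.
Arguments tens1o {s} A.
Arguments tenso1 {s} A.

Notation "A ⊗ B" := (tens A B).
Notation "f ⊠ g" := (tensm f g).
(* P ◁ f and f ▷ P are the morphisms P ⊗ f and f ⊗ P. *)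
Notation "P ◁ f" := (tensm (idm P) f) (at level 30, right associativity).
Notation "f ▷ P" := (tensm f (idm P)) (at level 30, right associativity).

Section StrictIdentities.
Variable C : strict_monoidal.
Definition asso (A B X : C) : hom ((A ⊗ B) ⊗ X) (A ⊗ (B ⊗ X)) :=
  idto (tensA A B X).
Definition assoV (A B X : C) : hom (A ⊗ (B ⊗ X)) ((A ⊗ B) ⊗ X) :=
  idto (eq_sym (tensA A B X)).
Definition unitl (A : C) : hom (K ⊗ A) A := idto (tens1o A).
Definition unitr (A : C) : hom (A ⊗ K) A := idto (tenso1 A).
End StrictIdentities.
Arguments asso {C} A B X.
Arguments assoV {C} A B X.
Arguments unitl {C} A.
Arguments unitr {C} A.

Record strict_braided := StrictBraided {
  bcat :> strict_monoidal;
  br : forall A B : bcat, hom (A ⊗ B) (B ⊗ A);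
  br_iso : forall A B, is_iso (br A B);
  br_nat : forall (A A' B B' : bcat) (f : hom A A') (g : hom B B'),
    br A' B' ∘ (f ⊠ g) = (g ⊠ f) ∘ br A B;
  br_hexl : forall A B X : bcat,
    asso B X A ∘ br A (B ⊗ X) ∘ asso A B X
    = (B ◁ br A X) ∘ asso B A X ∘ (br A B ▷ X);
  br_hexr : forall A B X : bcat,
    assoV X A B ∘ br (A ⊗ B) X ∘ assoV A B X
    = (br A X ▷ B) ∘ assoV A X B ∘ (A ◁ br B X) }.

Arguments br {s} A B.

(* The morphism A ⊗ c_{B,X} ⊗ D, with both ends bracketed in pairs. *)
Definition midswap (C : strict_braided) (A B X D : C) :
  hom ((A ⊗ B) ⊗ (X ⊗ D)) ((A ⊗ X) ⊗ (B ⊗ D)) :=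
  assoV A X (B ⊗ D)
  ∘ (A ◁ (asso X B D ∘ (br B X ▷ D) ∘ assoV B X D))
  ∘ asso A B (X ⊗ D).
Arguments midswap {C} A B X D.

Section Structures.
Variable C : strict_braided.

Record comonoid_data := ComonoidData {
  ccar :> C;
  counit : hom ccar K;
  coprod : hom ccar (ccar ⊗ ccar) }.

Definition is_comonoid (D : comonoid_data) : Prop :=
  [/\ asso D D D ∘ (coprod D ▷ D) ∘ coprod D = (D ◁ coprod D) ∘ coprod D,
      unitl D ∘ (counit D ▷ D) ∘ coprod D = idm D
    & unitr D ∘ (D ◁ counit D) ∘ coprod D = idm D].

Record comonoid := Comonoid {
  cdata :> comonoid_data;
  comonoidP : is_comonoid cdata }.

Definition comonoid_morphism (D E : comonoid_data) (f : hom D E) : Prop :=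
  counit E ∘ f = counit D /\ coprod E ∘ f = (f ⊠ f) ∘ coprod D.

Definition comonoid_unit : comonoid_data :=
  @ComonoidData K (idm K) (idto (eq_sym (tens1o K))).

Definition comonoid_tens (D E : comonoid_data) : comonoid_data :=
  @ComonoidData (D ⊗ E)
    (unitl K ∘ (counit D ⊠ counit E))
    (midswap D D E E ∘ (coprod D ⊠ coprod E)).

Definition assoc_product (A : C) (mu : hom (A ⊗ A) A) : Prop :=
  mu ∘ (mu ▷ A) = mu ∘ (A ◁ mu) ∘ asso A A A.

Definition is_monoid (A : C) (eta : hom K A) (mu : hom (A ⊗ A) A) : Prop :=
  [/\ assoc_product mu,
      mu ∘ (eta ▷ A) = unitl A
    & mu ∘ (A ◁ eta) = unitr A].

Definition is_nubimonoid (B : comonoid) (mu : hom (B ⊗ B) B) : Prop :=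
  assoc_product mu /\
  comonoid_morphism (D := comonoid_tens B B) (E := B) mu.

Definition is_bimonoid (H : comonoid) (eta : hom K H) (mu : hom (H ⊗ H) H) :
  Prop :=
  [/\ is_monoid eta mu,
      comonoid_morphism (D := comonoid_unit) (E := H) eta
    & comonoid_morphism (D := comonoid_tens H H) (E := H) mu].

Definition is_hopf_monoid (H : comonoid) (eta : hom K H) (mu : hom (H ⊗ H) H)
  (lam : hom H H) : Prop :=
  [/\ is_bimonoid eta mu,
      mu ∘ (H ◁ lam) ∘ coprod H = eta ∘ counit H
    & mu ∘ (lam ▷ H) ∘ coprod H = eta ∘ counit H].

Record nubimonoid := Nubimonoid {
  nb_comonoid :> comonoid;
  nb_mul : hom (nb_comonoid ⊗ nb_comonoid) nb_comonoid;
  nubimonoidP : is_nubimonoid nb_mul }.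

Record hopf_monoid := HopfMonoid {
  hm_comonoid :> comonoid;
  hm_unit : hom K hm_comonoid;
  hm_mul : hom (hm_comonoid ⊗ hm_comonoid) hm_comonoid;
  hm_antip : hom hm_comonoid hm_comonoid;
  hopf_monoidP : is_hopf_monoid hm_unit hm_mul hm_antip }.

Definition assoc_action (B M : C) (mu : hom (B ⊗ B) B) (act : hom (B ⊗ M) M) :
  Prop :=
  act ∘ (B ◁ act) ∘ asso B B M = act ∘ (mu ▷ M).

Definition is_left_module (A M : C) (eta : hom K A) (mu : hom (A ⊗ A) A)
  (act : hom (A ⊗ M) M) : Prop :=
  assoc_action mu act /\ act ∘ (eta ▷ M) = unitl M.

Definition linear (A M M' : C) (act : hom (A ⊗ M) M) (act' : hom (A ⊗ M') M')
  (f : hom M M') : Prop :=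
  f ∘ act = act' ∘ (A ◁ f).

(* act ∘ (f ⊗ g) ∘ (δ_D ⊗ X), the associativity identity being explicit. *)
Definition conv (D : comonoid_data) (A X M : C) (act : hom (A ⊗ M) M)
  (f : hom D A) (g : hom (D ⊗ X) M) : hom (D ⊗ X) M :=
  act ∘ (f ⊠ g) ∘ asso D D X ∘ (coprod D ▷ X).

(* act ∘ (u ⊗ v) ∘ (D ⊗ c_{D,X} ⊗ Y) ∘ (δ_D ⊗ X ⊗ Y) *)
Definition diag (D : comonoid_data) (A X Y M : C) (act : hom (A ⊗ M) M)
  (u : hom (D ⊗ X) A) (v : hom (D ⊗ Y) M) : hom (D ⊗ (X ⊗ Y)) M :=
  act ∘ (u ⊠ v) ∘ midswap D D X Y ∘ (coprod D ▷ (X ⊗ Y)).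

(* Γ = act ∘ ((λ ∘ σ) ⊗ act2) ∘ (δ_H ⊗ M), act and act2 being the actions of
   H_1 and H_2 on M; for M = H these are the two products.                  *)
Definition Gam (H : comonoid) (lam sigma : hom H H) (M : C)
  (act act2 : hom (H ⊗ M) M) : hom (H ⊗ M) M :=
  conv act (lam ∘ sigma) act2.

Record hopf_truss := HopfTruss {
  ht_comonoid :> comonoid;
  ht_unit : hom K ht_comonoid;
  ht_mul1 : hom (ht_comonoid ⊗ ht_comonoid) ht_comonoid;
  ht_mul2 : hom (ht_comonoid ⊗ ht_comonoid) ht_comonoid;
  ht_antip : hom ht_comonoid ht_comonoid;
  ht_sigma : hom ht_comonoid ht_comonoid;
  ht_hopf : is_hopf_monoid ht_unit ht_mul1 ht_antip;
  ht_nubimonoid : is_nubimonoid ht_mul2;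
  ht_sigma_comonoid :
    comonoid_morphism (D := ht_comonoid) (E := ht_comonoid) ht_sigma;
  ht_compat :
    ht_mul2 ∘ (ht_comonoid ◁ ht_mul1)
    = diag ht_mul1 ht_mul2 (Gam ht_antip ht_sigma ht_mul1 ht_mul2) }.

Record truss_module (T : hopf_truss) := TrussModule {
  tm_car :> C;
  tm_act1 : hom (T ⊗ tm_car) tm_car;
  tm_act2 : hom (T ⊗ tm_car) tm_car;
  tm_module1 : is_left_module (ht_unit T) (ht_mul1 T) tm_act1;
  tm_module2 : assoc_action (ht_mul2 T) tm_act2;
  tm_compat :
    tm_act2 ∘ (T ◁ tm_act1)
    = diag tm_act1 (ht_mul2 T) (Gam (ht_antip T) (ht_sigma T) tm_act1 tm_act2) }.

Record module_monoid_action (B : nubimonoid) (H : hopf_monoid) :=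
  ModuleMonoidAction {
  mm_act :> hom (B ⊗ H) H;
  mm_assoc : assoc_action (nb_mul B) mm_act;
  mm_unit :
    mm_act ∘ (B ◁ hm_unit H) = unitl H ∘ (counit B ⊠ hm_unit H);
  mm_mul : mm_act ∘ (B ◁ hm_mul H) = diag (hm_mul H) mm_act mm_act }.

Record gen_inv_1cocycle (B : nubimonoid) (H : hopf_monoid)
  (phi : module_monoid_action B H) := GenInv1cocycle {
  gc_pi : iso B H;
  gc_theta : hom B B;
  gc_pi_comonoid : comonoid_morphism (D := B) (E := H) gc_pi;
  gc_theta_comonoid : comonoid_morphism (D := B) (E := B) gc_theta;
  gc_cocycle :
    gc_pi ∘ nb_mul B
    = hm_mul H ∘ ((gc_pi ∘ gc_theta) ⊠ phi) ∘ asso B B H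
      ∘ (coprod B ⊠ gc_pi) }.

Record cocycle_module (B : nubimonoid) (H : hopf_monoid)
  (phi : module_monoid_action B H) (p : gen_inv_1cocycle phi) :=
  CocycleModule {
  cm_M : C;
  cm_N : C;
  cm_phiM : hom (B ⊗ cm_M) cm_M;
  cm_varphiM : hom (H ⊗ cm_M) cm_M;
  cm_phiN : hom (B ⊗ cm_N) cm_N;
  cm_gamma : iso cm_N cm_M;
  cm_moduleM : is_left_module (hm_unit H) (hm_mul H) cm_varphiM;
  cm_moduleN : assoc_action (nb_mul B) cm_phiN;
  cm_compat : cm_phiM ∘ (B ◁ cm_varphiM) = diag cm_varphiM phi cm_phiM;
  cm_cocycle :
    cm_gamma ∘ cm_phiN
    = cm_varphiM ∘ ((gc_pi p ∘ gc_theta p) ⊠ cm_phiM) ∘ asso B B cm_M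
      ∘ (coprod B ⊠ cm_gamma) }.

End Structures.

Section Calculus.
Variable C : strict_braided.

Lemma heq_tensm (A B A' B' X Y X' Y' : C) (f : hom A B) (g : hom A' B')
  (f' : hom X Y) (g' : hom X' Y') :
  heq f f' -> heq g g' -> heq (f ⊠ g) (f' ⊠ g').
Proof.
move=> [p [q Ef]] [r [s Eg]].
case: _ / p f' Ef => f'; case: _ / q f' => f'.
case: _ / r g' Eg => g'; case: _ / s g' => g' /=.
by rewrite !comp1m !compm1 => -> ->; exact: heq_refl.
Qed.

Lemma heq_tensmA (A B X A' B' X' : C) (f : hom A A') (g : hom B B')
  (h : hom X X') : heq ((f ⊠ g) ⊠ h) (f ⊠ (g ⊠ h)).
Proof. by exists (tensA A B X), (tensA A' B' X'); exact: tensmA. Qed.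

Lemma tensm_split (A A' B B' : C) (f : hom A A') (g : hom B B') :
  f ⊠ g = (A' ◁ g) ∘ (f ▷ B).
Proof. by rewrite -tensm_comp comp1m compm1. Qed.

Lemma tensm_split' (A A' B B' : C) (f : hom A A') (g : hom B B') :
  f ⊠ g = (f ▷ B') ∘ (A ◁ g).
Proof. by rewrite -tensm_comp comp1m compm1. Qed.

Lemma whiskl_comp (P A B X : C) (g : hom B X) (f : hom A B) :
  P ◁ (g ∘ f) = (P ◁ g) ∘ (P ◁ f).
Proof. by rewrite -tensm_comp comp1m. Qed.

Lemma whiskr_comp (P A B X : C) (g : hom B X) (f : hom A B) :
  (g ∘ f) ▷ P = (g ▷ P) ∘ (f ▷ P).
Proof. by rewrite -tensm_comp comp1m. Qed.

Lemma assoK (A B X : C) : assoV A B X ∘ asso A B X = idm _.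
Proof. by rewrite /assoV /asso; case: _ / (tensA A B X) => /=; rewrite comp1m. Qed.

Lemma assoVK (A B X : C) : asso A B X ∘ assoV A B X = idm _.
Proof. by rewrite /assoV /asso; case: _ / (tensA A B X) => /=; rewrite comp1m. Qed.

Lemma asso_nat (A B X A' B' X' : C) (f : hom A A') (g : hom B B')
  (h : hom X X') :
  asso A' B' X' ∘ ((f ⊠ g) ⊠ h) = (f ⊠ (g ⊠ h)) ∘ asso A B X.
Proof. exact: tensmA. Qed.

Lemma assoV_nat (A B X A' B' X' : C) (f : hom A A') (g : hom B B')
  (h : hom X X') :
  assoV A' B' X' ∘ (f ⊠ (g ⊠ h)) = ((f ⊠ g) ⊠ h) ∘ assoV A B X.
Proof.
by rewrite -[f ⊠ (g ⊠ h)]compm1 -assoVK !compA -[_ ∘ _ ∘ asso _ _ _]compA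
  -asso_nat compA assoK comp1m.
Qed.

Lemma swap_nat (B X D B' X' D' : C) (g : hom B B') (h : hom X X')
  (k : hom D D') :
  asso X' B' D' ∘ (br B' X' ▷ D') ∘ assoV B' X' D' ∘ (g ⊠ (h ⊠ k))
  = (h ⊠ (g ⊠ k)) ∘ (asso X B D ∘ (br B X ▷ D) ∘ assoV B X D).
Proof.
rewrite -!compA assoV_nat (compA (br B' X' ▷ D')) -tensm_comp br_nat comp1m.
by rewrite -(compm1 k) tensm_comp (compm1 k) !compA asso_nat.
Qed.

Lemma midswap_nat (A B X D A' B' X' D' : C) (f : hom A A') (g : hom B B')
  (h : hom X X') (k : hom D D') :
  midswap A' B' X' D' ∘ ((f ⊠ g) ⊠ (h ⊠ k))
  = ((f ⊠ h) ⊠ (g ⊠ k)) ∘ midswap A B X D.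
Proof.
rewrite /midswap -[_ ∘ asso _ _ _ ∘ _]compA asso_nat.
rewrite compA -[_ ∘ _ ∘ (f ⊠ _)]compA -tensm_comp comp1m swap_nat.
by rewrite -(compm1 f) tensm_comp (compm1 f) !compA assoV_nat.
Qed.

Lemma heq_midswap (A B X D : C) :
  heq (midswap A B X D) (A ◁ (br B X ▷ D)).
Proof.
apply: heq_trans (heq_idtoR _ _) _.
apply: heq_trans (heq_idtoL _ _) _.
apply: heq_tensm; first exact: heq_refl.
apply: heq_trans (heq_idtoR _ _) _.
exact: heq_idtoL.
Qed.

Section Actions.
Variables (D : comonoid_data C) (A : C).
Variables (mu : hom (A ⊗ A) A).

Lemma conv_nat (M X X' : C) (act : hom (A ⊗ M) M) (f : hom D A)
  (g : hom (D ⊗ X) M) (h : hom X' X) :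
  conv act f g ∘ (D ◁ h) = conv act f (g ∘ (D ◁ h)).
Proof.
rewrite /conv -!compA -tensm_split' [coprod D ⊠ h]tensm_split.
rewrite -[idm (D ⊗ D)]tensm_id (compA (asso _ _ _)) asso_nat.
by rewrite !compA -[act ∘ _ ∘ _]compA -tensm_comp compm1.
Qed.

Hypothesis Dcomon : is_comonoid D.

Let dd := (D ◁ coprod D) ∘ coprod D.

Lemma heq_coprodl (Z : C) :
  heq ((coprod D ▷ (D ⊗ Z)) ∘ (asso D D Z ∘ (coprod D ▷ Z))) (dd ▷ Z).
Proof.
case: Dcomon => coA _ _; rewrite /dd -coA -compA.
apply: heq_trans (heq_sym (heq_tensm (heq_idtoL _ _) (heq_refl _))).
rewrite whiskr_comp -(tensm_id D Z); apply: heq_comp; last exact: heq_idtoL.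
exact: heq_sym (heq_tensmA _ _ _).
Qed.

Lemma heq_coprodr (Z : C) :
  heq ((D ◁ (coprod D ▷ Z)) ∘ (asso D D Z ∘ (coprod D ▷ Z))) (dd ▷ Z).
Proof.
rewrite /dd whiskr_comp; apply: heq_comp; last exact: heq_idtoL.
exact: heq_sym (heq_tensmA _ _ _).
Qed.

Lemma conv_conv (M X : C) (act : hom (A ⊗ M) M) (f f' : hom D A)
  (g : hom (D ⊗ X) M) :
  assoc_action mu act ->
  conv act f (conv act f' g)
  = conv act (mu ∘ (f ⊠ f') ∘ coprod D) g.
Proof.
move=> actA; rewrite /conv.
have -> : f ⊠ (act ∘ (f' ⊠ g) ∘ asso D D X ∘ (coprod D ▷ X))
  = (A ◁ act) ∘ (f ⊠ (f' ⊠ g)) ∘ (D ◁ (asso D D X ∘ (coprod D ▷ X))).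
  by rewrite -!tensm_comp !comp1m !compm1 !compA.
have -> : (mu ∘ (f ⊠ f') ∘ coprod D) ⊠ g
  = (mu ▷ M) ∘ ((f ⊠ f') ⊠ g) ∘ (coprod D ▷ (D ⊗ X)).
  by rewrite -!tensm_comp !comp1m compm1.
rewrite !compA -actA -[_ ∘ asso A A M ∘ _]compA asso_nat.
rewrite -!compA; do 3!congr (_ ∘ _); apply: heq_eq.
apply: (@heq_trans _ _ _ _ _ _ _ (dd ▷ X)).
  apply: heq_trans (heq_coprodr X); apply: heq_comp; last exact: heq_refl.
  by apply: heq_tensm; [exact: heq_refl | exact: heq_idtoL].
apply: heq_sym; apply: heq_trans (heq_coprodl X); exact: heq_idtoL.
Qed.

Lemma heq_coprod_midswap (X Y : C) :
  heq ((D ◁ (midswap D D X Y ∘ (coprod D ▷ (X ⊗ Y))))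
       ∘ (asso D D (X ⊗ Y) ∘ (coprod D ▷ (X ⊗ Y))))
      (((asso D D X ∘ (coprod D ▷ X)) ▷ (D ⊗ Y))
       ∘ (midswap D D X Y ∘ (coprod D ▷ (X ⊗ Y)))).
Proof.
pose s := D ◁ (D ◁ (br D X ▷ Y)).
have e : (D ⊗ (D ⊗ D)) ⊗ (X ⊗ Y) = D ⊗ (D ⊗ ((D ⊗ X) ⊗ Y)).
  by rewrite !tensA.
apply: (@heq_trans _ _ _ _ _ _ _ (s ∘ (idto e ∘ (dd ▷ (X ⊗ Y))))).
  rewrite whiskl_comp -compA; apply: heq_comp.
    apply: heq_tensm; [exact: heq_refl | exact: heq_midswap].
  exact: heq_trans (heq_coprodr _) (heq_sym (heq_idtoL _ _)).
apply: heq_sym.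
apply: (@heq_trans _ _ _ _ _ _ _
  (midswap (D ⊗ D) D X Y
   ∘ (((coprod D ▷ D) ▷ (X ⊗ Y)) ∘ (coprod D ▷ (X ⊗ Y))))).
  apply: (@heq_trans _ _ _ _ _ _ _
    (((coprod D ▷ X) ▷ (D ⊗ Y))
     ∘ (midswap D D X Y ∘ (coprod D ▷ (X ⊗ Y))))).
    apply: heq_comp; last exact: heq_refl.
    by apply: heq_tensm; [exact: heq_idtoL | exact: heq_refl].
  apply: eq_heq.
  rewrite -(tensm_id D Y) (compA _ (midswap D D X Y)) -midswap_nat.
  by rewrite (tensm_id X Y) -compA.
apply: heq_comp.
  apply: heq_trans (heq_midswap _ _ _ _) _.
  rewrite -(tensm_id D D); exact: heq_tensmA.
rewrite -whiskr_comp.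
apply: heq_trans (heq_sym (heq_idtoL _ _)).
case: Dcomon => coA _ _; rewrite /dd -coA -compA.
by apply: heq_tensm; [exact: heq_sym (heq_idtoL _ _) | exact: heq_refl].
Qed.

Lemma conv_diag (M X Y : C) (act : hom (A ⊗ M) M) (f : hom D A)
  (u : hom (D ⊗ X) A) (v : hom (D ⊗ Y) M) :
  assoc_action mu act ->
  conv act f (diag act u v) = diag act (conv mu f u) v.
Proof.
move=> actA; rewrite /conv /diag.
move: (midswap D D X Y) (heq_coprod_midswap X Y) => m coh.
have -> : f ⊠ (act ∘ (u ⊠ v) ∘ m ∘ (coprod D ▷ (X ⊗ Y)))
  = (A ◁ act) ∘ (f ⊠ (u ⊠ v))
    ∘ (D ◁ (m ∘ (coprod D ▷ (X ⊗ Y)))).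
  by rewrite -!tensm_comp !comp1m !compm1 !compA.
have -> : (mu ∘ (f ⊠ u) ∘ asso D D X ∘ (coprod D ▷ X)) ⊠ v
  = (mu ▷ M) ∘ ((f ⊠ u) ⊠ v) ∘ ((asso D D X ∘ (coprod D ▷ X)) ▷ (D ⊗ Y)).
  by rewrite -!tensm_comp !comp1m !compm1 !compA.
rewrite !compA -actA -[_ ∘ asso A A M ∘ _]compA asso_nat.
rewrite -!compA; do 3!congr (_ ∘ _); apply: heq_eq.
exact: heq_trans coh (heq_sym (heq_idtoL _ _)).
Qed.

Lemma conv_unit (M X : C) (eta : hom K A) (act : hom (A ⊗ M) M)
  (g : hom (D ⊗ X) M) :
  act ∘ (eta ▷ M) = unitl M -> conv act (eta ∘ counit D) g = g.
Proof.
case: Dcomon => _ counitP _ act1; rewrite /conv.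
have -> : (eta ∘ counit D) ⊠ g = (eta ▷ M) ∘ (K ◁ g) ∘ (counit D ▷ (D ⊗ X)).
  by rewrite -!tensm_comp !comp1m !compm1.
rewrite !compA act1 /unitl tens1m -!compA.
rewrite -[RHS]compm1; congr (_ ∘ _); apply: heq_eq.
apply: heq_trans (heq_idtoL _ _) _.
have E : (unitl D ∘ ((counit D ▷ D) ∘ coprod D)) ▷ X = idm (D ⊗ X).
  by rewrite compA counitP tensm_id.
apply: heq_trans (eq_heq E).
apply: heq_trans (heq_sym (heq_tensm (heq_idtoL _ _) (heq_refl _))).
rewrite whiskr_comp -(tensm_id D X); apply: heq_comp; last exact: heq_idtoL.
exact: heq_sym (heq_tensmA _ _ _).
Qed.

End Actions.

Lemma conv_comonoid (D E : comonoid_data C) (x : hom E D) (A M X : C)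
  (act : hom (A ⊗ M) M) (f : hom D A) (g : hom (D ⊗ X) M) :
  comonoid_morphism x ->
  conv act f g ∘ (x ▷ X) = conv act (f ∘ x) (g ∘ (x ▷ X)).
Proof.
case=> _ xP; rewrite /conv -!compA -whiskr_comp xP whiskr_comp.
rewrite (compA (asso _ _ _)) asso_nat !compA -(compA act (f ⊠ g)).
by rewrite -tensm_comp.
Qed.

Lemma diag_comonoid (D E : comonoid_data C) (x : hom E D) (A M X Y : C)
  (act : hom (A ⊗ M) M) (u : hom (D ⊗ X) A) (v : hom (D ⊗ Y) M) :
  comonoid_morphism x ->
  diag act u v ∘ (x ▷ (X ⊗ Y)) = diag act (u ∘ (x ▷ X)) (v ∘ (x ▷ Y)).
Proof.
case=> _ xP; rewrite /diag.
have := midswap_nat x x (idm X) (idm Y).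
move: (midswap D D X Y) (midswap E E X Y) => m m' mE.
rewrite -!compA -whiskr_comp xP whiskr_comp -(tensm_id X Y).
rewrite (compA m) mE tensm_id !compA -(compA act (u ⊠ v)).
by rewrite -tensm_comp.
Qed.

Lemma comonoid_morphism_comp (D E F : comonoid_data C) (g : hom E F)
  (f : hom D E) :
  comonoid_morphism g -> comonoid_morphism f -> comonoid_morphism (g ∘ f).
Proof.
case=> g1 g2 [f1 f2]; split; first by rewrite compA g1 f1.
by rewrite compA g2 -compA f2 compA -tensm_comp.
Qed.

Lemma comonoid_morphism_tens (D E D' E' : comonoid_data C) (f : hom D E)
  (f' : hom D' E') :
  comonoid_morphism f -> comonoid_morphism f' ->
  comonoid_morphism (D := comonoid_tens D D') (E := comonoid_tens E E') (f ⊠ f').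
Proof.
case=> f1 f2 [f1' f2']; split => /=.
  by rewrite -compA -tensm_comp f1 f1'.
rewrite -compA -tensm_comp f2 f2' tensm_comp.
have := midswap_nat f f f' f'.
move: (midswap _ _ _ _) (midswap _ _ _ _) => m m' mE.
by rewrite !compA mE.
Qed.

Lemma comonoid_morphism_inv (D E : comonoid_data C) (f : iso D E) :
  comonoid_morphism f -> comonoid_morphism (inv f).
Proof.
case=> f1 f2; split.
  by rewrite -f1 -compA fwdK compm1.
rewrite -[LHS]comp1m -(tensm_id D D) -(invK f) tensm_comp -compA.
by rewrite (compA _ (coprod D)) -f2 -compA fwdK compm1.
Qed.

Lemma conv_antipode (H : comonoid C) (eta : hom K H) (mu : hom (H ⊗ H) H)
  (lam sigma : hom H H) (M X : C) (act : hom (H ⊗ M) M) (g : hom (H ⊗ X) M) :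
  is_hopf_monoid eta mu lam -> comonoid_morphism sigma ->
  is_left_module eta mu act ->
  conv act (lam ∘ sigma) (conv act sigma g) = g.
Proof.
case=> _ _ lamP [s1 s2] [actA act1].
rewrite (conv_conv (comonoidP H) _ _ _ actA).
have -> : mu ∘ ((lam ∘ sigma) ⊠ sigma) ∘ coprod H = eta ∘ counit H.
  rewrite -[sigma in _ ⊠ sigma]comp1m tensm_comp -!compA -s2.
  by rewrite !compA lamP -compA s1.
exact: (conv_unit (comonoidP H) _ act1).
Qed.

Lemma hopf_regular_module (H : hopf_monoid C) :
  is_left_module (hm_unit H) (hm_mul H) (hm_mul H).
Proof. by case: (hopf_monoidP H) => [[[muA mu1 _] _ _] _ _]; split. Qed.

End Calculus.

Section CocycleTruss.
Variables (C : strict_braided) (B : nubimonoid C) (H : hopf_monoid C).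
Variables (phi : module_monoid_action B H) (p : gen_inv_1cocycle phi).

Local Notation pi := (gc_pi p).

Definition ct_mul : hom (H ⊗ H) H := pi ∘ nb_mul B ∘ (inv pi ⊠ inv pi).

Definition ct_sigma : hom H H := pi ∘ gc_theta p ∘ inv pi.

Lemma ct_inv_comonoid : comonoid_morphism (D := H) (E := B) (inv pi).
Proof. exact: comonoid_morphism_inv (gc_pi_comonoid p). Qed.

Lemma ct_sigma_comonoid : comonoid_morphism (D := H) (E := H) ct_sigma.
Proof.
apply: comonoid_morphism_comp ct_inv_comonoid.
exact: comonoid_morphism_comp (gc_pi_comonoid p) (gc_theta_comonoid p).
Qed.

Lemma ct_nubimonoid : is_nubimonoid ct_mul.
Proof.
case: (nubimonoidP B) => muA muC; split; last first.
  apply: (@comonoid_morphism_comp _ (comonoid_tens H H) (comonoid_tens B B) H).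
    exact: (@comonoid_morphism_comp _ _ B _ _ _ (gc_pi_comonoid p) muC).
  exact: comonoid_morphism_tens ct_inv_comonoid ct_inv_comonoid.
rewrite /assoc_product /ct_mul.
have -> : (pi ∘ nb_mul B ∘ (inv pi ⊠ inv pi)) ▷ H
  = (pi ⊠ pi) ∘ (nb_mul B ▷ B) ∘ ((inv pi ⊠ inv pi) ⊠ inv pi).
  by rewrite -!tensm_comp compm1 fwdK.
have -> : H ◁ (pi ∘ nb_mul B ∘ (inv pi ⊠ inv pi))
  = (pi ⊠ pi) ∘ (B ◁ nb_mul B) ∘ (inv pi ⊠ (inv pi ⊠ inv pi)).
  by rewrite -!tensm_comp compm1 fwdK.
have invpi (X : C) (f : hom X (B ⊗ B)) :
  (inv pi ⊠ inv pi) ∘ ((pi ⊠ pi) ∘ f) = f.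
  by rewrite compA -tensm_comp invK tensm_id comp1m.
rewrite -!compA !invpi -asso_nat; congr (_ ∘ _).
by rewrite !compA muA.
Qed.

Let phi' : hom (H ⊗ H) H := phi ∘ (inv pi ▷ H).

Lemma ct_mulE : ct_mul = conv (D := H) (hm_mul H) ct_sigma phi'.
Proof.
rewrite /ct_mul.
have -> : pi ∘ nb_mul B
  = conv (D := B) (hm_mul H) (pi ∘ gc_theta p) phi ∘ (B ◁ pi).
  by rewrite gc_cocycle /conv -!compA -tensm_split'.
rewrite -compA -tensm_comp comp1m fwdK.
exact: conv_comonoid ct_inv_comonoid.
Qed.

Lemma ct_Gam : Gam (H := H) (hm_antip H) ct_sigma (hm_mul H) ct_mul = phi'.
Proof.
rewrite /Gam ct_mulE.
exact: conv_antipode (hopf_monoidP H) ct_sigma_comonoid (hopf_regular_module H).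
Qed.

Lemma ct_compat :
  ct_mul ∘ (H ◁ hm_mul H)
  = diag (D := H) (hm_mul H) ct_mul
      (Gam (H := H) (hm_antip H) ct_sigma (hm_mul H) ct_mul).
Proof.
have [muA _] := hopf_regular_module H.
rewrite ct_Gam ct_mulE conv_nat.
have -> : phi' ∘ (H ◁ hm_mul H) = diag (D := H) (hm_mul H) phi' phi'.
  rewrite /phi' -compA -tensm_split' tensm_split compA mm_mul.
  exact: diag_comonoid ct_inv_comonoid.
exact: (conv_diag (comonoidP H) ct_sigma phi' phi' muA).
Qed.

(* ℍ_π = (H, H_π, σ_π) with product μ_H^π = ct_mul and σ_π = ct_sigma. *)
Definition cocycle_truss : hopf_truss C :=
  @HopfTruss C H (hm_unit H) (hm_mul H) ct_mul (hm_antip H) ct_sigma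
    (hopf_monoidP H) ct_nubimonoid ct_sigma_comonoid ct_compat.

End CocycleTruss.

Lemma sig_eq (T : Type) (P : T -> Prop) (x y : {t : T | P t}) :
  proj1_sig x = proj1_sig y -> x = y.
Proof.
case: x y => [x Px] [y Py] /= exy; case: _ / exy Py => Py.
by rewrite (proof_irrelevance _ Px Py).
Qed.

Section ModuleCategories.
Variable C : strict_braided.

Lemma linear_id (A M : C) (act : hom (A ⊗ M) M) : linear act act (idm M).
Proof. by rewrite /linear tensm_id comp1m compm1. Qed.

Lemma linear_comp (A M M' M'' : C) (act : hom (A ⊗ M) M)
  (act' : hom (A ⊗ M') M') (act'' : hom (A ⊗ M'') M'') (g : hom M' M'')
  (f : hom M M') :
  linear act' act'' g -> linear act act' f -> linear act act'' (g ∘ f).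
Proof.
by rewrite /linear => gl fl; rewrite -compA fl compA gl whiskl_comp compA.
Qed.

Section TrussMod.
Variable T : hopf_truss C.

Definition truss_hom (X Y : truss_module T) : Type :=
  {f : hom X Y | linear (tm_act1 X) (tm_act1 Y) f
                 /\ linear (tm_act2 X) (tm_act2 Y) f}.

Definition truss_id (X : truss_module T) : truss_hom X X :=
  exist _ (idm X) (conj (linear_id _) (linear_id _)).

Definition truss_comp (X Y Z : truss_module T) (g : truss_hom Y Z)
  (f : truss_hom X Y) : truss_hom X Z :=
  exist _ (proj1_sig g ∘ proj1_sig f)
    (conj (linear_comp (proj1 (proj2_sig g)) (proj1 (proj2_sig f)))
          (linear_comp (proj2 (proj2_sig g)) (proj2 (proj2_sig f)))).

Lemma truss_compA (X Y Z W : truss_module T) (h : truss_hom Z W)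
  (g : truss_hom Y Z) (f : truss_hom X Y) :
  truss_comp h (truss_comp g f) = truss_comp (truss_comp h g) f.
Proof. apply: sig_eq; exact: compA. Qed.

Lemma truss_comp1m (X Y : truss_module T) (f : truss_hom X Y) :
  truss_comp (truss_id Y) f = f.
Proof. apply: sig_eq; exact: comp1m. Qed.

Lemma truss_compm1 (X Y : truss_module T) (f : truss_hom X Y) :
  truss_comp f (truss_id X) = f.
Proof. apply: sig_eq; exact: compm1. Qed.

Definition truss_Mod : category :=
  Category truss_compA truss_comp1m truss_compm1.

End TrussMod.

Section CocycleMod.
Variables (B : nubimonoid C) (H : hopf_monoid C).
Variables (phi : module_monoid_action B H) (p : gen_inv_1cocycle phi).

Definition is_cocycle_hom (X Y : cocycle_module p)
  (hl : hom (cm_M X) (cm_M Y) * hom (cm_N X) (cm_N Y)) : Prop :=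
  [/\ linear (cm_phiM X) (cm_phiM Y) (fst hl),
      linear (cm_varphiM X) (cm_varphiM Y) (fst hl),
      linear (cm_phiN X) (cm_phiN Y) (snd hl)
    & fst hl ∘ cm_gamma X = cm_gamma Y ∘ snd hl].

Definition cocycle_hom (X Y : cocycle_module p) : Type :=
  {hl : hom (cm_M X) (cm_M Y) * hom (cm_N X) (cm_N Y) | is_cocycle_hom hl}.

Lemma is_cocycle_hom_id (X : cocycle_module p) :
  is_cocycle_hom (idm (cm_M X), idm (cm_N X)).
Proof. by split; rewrite /= ?comp1m ?compm1 //; exact: linear_id. Qed.

Lemma is_cocycle_hom_comp (X Y Z : cocycle_module p) (g : cocycle_hom Y Z)
  (f : cocycle_hom X Y) :
  is_cocycle_hom (fst (proj1_sig g) ∘ fst (proj1_sig f),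
                  snd (proj1_sig g) ∘ snd (proj1_sig f)).
Proof.
case: g f => [[h l] [/= g1 g2 g3 g4]] [[h' l'] [/= f1 f2 f3 f4]]; split=> /=.
- exact: linear_comp g1 f1.
- exact: linear_comp g2 f2.
- exact: linear_comp g3 f3.
- by rewrite -compA f4 !compA g4.
Qed.

Definition cocycle_id (X : cocycle_module p) : cocycle_hom X X :=
  exist _ _ (is_cocycle_hom_id X).

Definition cocycle_comp (X Y Z : cocycle_module p) (g : cocycle_hom Y Z)
  (f : cocycle_hom X Y) : cocycle_hom X Z :=
  exist _ _ (is_cocycle_hom_comp g f).

Lemma cocycle_compA (X Y Z W : cocycle_module p) (h : cocycle_hom Z W)
  (g : cocycle_hom Y Z) (f : cocycle_hom X Y) :
  cocycle_comp h (cocycle_comp g f) = cocycle_comp (cocycle_comp h g) f.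
Proof. by apply: sig_eq; rewrite /= !compA. Qed.

Lemma cocycle_comp1m (X Y : cocycle_module p) (f : cocycle_hom X Y) :
  cocycle_comp (cocycle_id Y) f = f.
Proof. by apply: sig_eq; case: f => [[h l] ?]; rewrite /= !comp1m. Qed.

Lemma cocycle_compm1 (X Y : cocycle_module p) (f : cocycle_hom X Y) :
  cocycle_comp f (cocycle_id X) = f.
Proof. by apply: sig_eq; case: f => [[h l] ?]; rewrite /= !compm1. Qed.

Definition cocycle_Mod : category :=
  Category cocycle_compA cocycle_comp1m cocycle_compm1.

End CocycleMod.
End ModuleCategories.

(* Main.v *)
From Corelib Require Import ssreflect ssrbool.
Require Import Defs.

(** On a module over the cocycle, put [ψ² = γ ∘ φ_N ∘ (π⁻¹ ⊗ γ⁻¹)].  Condition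
    (v) says that [ψ²] is the convolution of [σ_π] with the transported action
    [φ_M ∘ (π⁻¹ ⊗ M)]; the antipode makes convolution by [σ_π] invertible, with
    inverse the convolution by [λ ∘ σ_π], so that [φ_M ∘ (π⁻¹ ⊗ M)] is exactly
    [Γ_M].  Hence [φ_M] and [ψ²] determine each other, the two compatibility
    conditions correspond under these convolutions, and [N] is carried along
    [γ]: the inverse functor takes [N = M] and [γ = id], and going back and
    forth changes a cocycle module only by the isomorphism [(id, γ⁻¹)]. *)

Set Implicit Arguments.
Unset Strict Implicit.
Unset Printing Implicit Defensive.

(** * Convolution by a comonoid morphism, and transport of actions along isomorphisms *)

Section Convolution.
Variable C : strict_braided.

(** Since [sigma] preserves coproduct and counit, the antipode identity precomposed with [sigma]
    collapses the combined factor to [eta ∘ counit H]. Together with [conv_antipode], this makes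
    convolution by [sigma] bijective. *)
Lemma conv_antipode_right (H : comonoid C) (eta : hom K H)
  (mu : hom (H ⊗ H) H) (lam sigma : hom H H) (M X : C)
  (act : hom (H ⊗ M) M) (g : hom (H ⊗ X) M) :
  is_hopf_monoid eta mu lam -> comonoid_morphism sigma ->
  is_left_module eta mu act ->
  conv act sigma (conv act (lam ∘ sigma) g) = g.
Proof.
case=> _ lamP _ [s1 s2] [actA act1].
rewrite (conv_conv (comonoidP H) _ _ _ actA).
have -> : mu ∘ (sigma ⊠ (lam ∘ sigma)) ∘ coprod H = eta ∘ counit H.
  rewrite -[sigma in sigma ⊠ _]comp1m tensm_comp -!compA -s2.
  by rewrite !compA lamP -compA s1.
exact: (conv_unit (comonoidP H) _ act1).
Qed.

(** Used with [h = k]: a morphism linear for both truss actions is also linear for Γ. *)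
Lemma linear_conv (D : comonoid_data C) (A X M X' M' : C)
  (act : hom (A ⊗ M) M) (act' : hom (A ⊗ M') M') (f : hom D A)
  (g : hom (D ⊗ X) M) (g' : hom (D ⊗ X') M') (h : hom X X') (k : hom M M') :
  linear act act' k -> k ∘ g = g' ∘ (D ◁ h) ->
  k ∘ conv act f g = conv act' f g' ∘ (D ◁ h).
Proof.
move=> kl kg; rewrite conv_nat -kg /conv !compA kl.
by rewrite -(compA act') -tensm_comp comp1m.
Qed.

Lemma linear_base_change (A B M M' : C) (act : hom (A ⊗ M) M)
  (act' : hom (A ⊗ M') M') (u : hom B A) (f : hom M M') :
  linear act act' f -> linear (act ∘ (u ▷ M)) (act' ∘ (u ▷ M')) f.
Proof.
rewrite /linear => fl.
by rewrite compA fl -!compA -tensm_split' -tensm_split.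
Qed.

Lemma iso_whiskrK (A B M X : C) (u : iso A B) (f : hom (B ⊗ M) X) :
  f ∘ (u ▷ M) ∘ (inv u ▷ M) = f.
Proof. by rewrite -compA -whiskr_comp fwdK tensm_id compm1. Qed.

Lemma iso_whiskrVK (A B M X : C) (u : iso A B) (f : hom (A ⊗ M) X) :
  f ∘ (inv u ▷ M) ∘ (u ▷ M) = f.
Proof. by rewrite -compA -whiskr_comp invK tensm_id compm1. Qed.

Definition iso_id (M : C) : iso M M :=
  Iso (comp1m (idm M)) (comp1m (idm M)).

End Convolution.

Section Equivalence.
Variables (C : strict_braided) (B : nubimonoid C) (H : hopf_monoid C).
Variables (phi : module_monoid_action B H) (p : gen_inv_1cocycle phi).

Local Notation pi := (gc_pi p).
Local Notation T := (cocycle_truss p).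

(** * From cocycle modules to truss modules *)

Section ToTruss.
Variable X : cocycle_module p.

Definition truss_act2 : hom (H ⊗ cm_M X) (cm_M X) :=
  cm_gamma X ∘ cm_phiN X ∘ (inv pi ⊠ inv (cm_gamma X)).

(** In condition (v), γ⁻¹ cancels γ, and the comonoid morphism π⁻¹ passes through the coproduct,
    turning π ∘ θ into σ_π. *)
Lemma truss_act2E :
  truss_act2
  = conv (D := H) (cm_varphiM X) (ct_sigma p) (cm_phiM X ∘ (inv pi ▷ cm_M X)).
Proof.
rewrite /truss_act2.
have -> : cm_gamma X ∘ cm_phiN X
  = conv (D := B) (cm_varphiM X) (pi ∘ gc_theta p) (cm_phiM X)
    ∘ (B ◁ cm_gamma X).
  by rewrite cm_cocycle /conv -!compA -tensm_split'.
rewrite -compA -tensm_comp comp1m fwdK.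
exact: conv_comonoid (ct_inv_comonoid p).
Qed.

Lemma Gam_truss_act2 :
  Gam (H := H) (hm_antip H) (ct_sigma p) (cm_varphiM X) truss_act2
  = cm_phiM X ∘ (inv pi ▷ cm_M X).
Proof.
rewrite /Gam truss_act2E.
exact: conv_antipode (hopf_monoidP H) (ct_sigma_comonoid p) (cm_moduleM X).
Qed.

(** Transport of structure: the action is [cm_phiN X] conjugated by π and γ, and [ct_mul p] is the
    product of [B] conjugated by π. *)
Lemma truss_act2_assoc : assoc_action (ct_mul p) truss_act2.
Proof.
have := cm_moduleN X; rewrite /assoc_action /truss_act2 /ct_mul => actA.
set g := cm_gamma X.
have -> : H ◁ (g ∘ cm_phiN X ∘ (inv pi ⊠ inv g))
  = (pi ⊠ g) ∘ (B ◁ cm_phiN X) ∘ (inv pi ⊠ (inv pi ⊠ inv g)).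
  by rewrite -!tensm_comp compm1 fwdK.
have -> : (pi ∘ nb_mul B ∘ (inv pi ⊠ inv pi)) ▷ cm_M X
  = (pi ⊠ g) ∘ (nb_mul B ▷ cm_N X) ∘ ((inv pi ⊠ inv pi) ⊠ inv g).
  by rewrite -!tensm_comp compm1 fwdK.
have cancel (Y : C) (f : hom Y (B ⊗ cm_N X)) :
  (inv pi ⊠ inv g) ∘ ((pi ⊠ g) ∘ f) = f.
  by rewrite compA -tensm_comp !invK tensm_id comp1m.
rewrite -!compA !cancel -asso_nat; congr (_ ∘ _).
by rewrite !compA actA.
Qed.

(** Condition (iv), carried along π⁻¹, makes the inner factor diagonal. Associativity of the
    [H]-action then moves the convolution by σ_π into the first factor, where it produces [ct_mul p]
    by [ct_mulE]. *)
Lemma truss_act2_compat :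
  truss_act2 ∘ (H ◁ cm_varphiM X)
  = diag (D := H) (cm_varphiM X) (ct_mul p)
      (Gam (H := H) (hm_antip H) (ct_sigma p) (cm_varphiM X) truss_act2).
Proof.
have [actA _] := cm_moduleM X.
rewrite Gam_truss_act2 truss_act2E conv_nat ct_mulE.
have -> : cm_phiM X ∘ (inv pi ▷ cm_M X) ∘ (H ◁ cm_varphiM X)
  = diag (D := H) (cm_varphiM X) (phi ∘ (inv pi ▷ H))
      (cm_phiM X ∘ (inv pi ▷ cm_M X)).
  rewrite -compA -tensm_split' tensm_split compA cm_compat.
  exact: diag_comonoid (ct_inv_comonoid p).
exact: (conv_diag (comonoidP H) (ct_sigma p) _ _ actA).
Qed.

Definition to_truss : truss_module T :=
  @TrussModule C T (cm_M X) (cm_varphiM X) truss_act2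
    (cm_moduleM X) truss_act2_assoc truss_act2_compat.

End ToTruss.

Lemma to_truss_is_hom (X Y : cocycle_module p) (f : cocycle_hom X Y) :
  linear (tm_act1 (to_truss X)) (tm_act1 (to_truss Y)) (fst (proj1_sig f))
  /\ linear (tm_act2 (to_truss X)) (tm_act2 (to_truss Y)) (fst (proj1_sig f)).
Proof.
case: f => [[h l] [/= _ hlin lN hl]]; split=> //.
rewrite /linear /truss_act2.
(* Only [h] survives in the truss; this form of the γ-square turns linearity of [l] into linearity
   of [h]. *)
have hl' : l ∘ inv (cm_gamma X) = inv (cm_gamma Y) ∘ h.
  rewrite -[LHS]comp1m -(invK (cm_gamma Y)) -(compA _ _ (l ∘ _)).
  by rewrite (compA (cm_gamma Y)) -hl -compA fwdK compm1.
rewrite !compA hl -(compA (cm_gamma Y)) lN -!compA -!tensm_comp.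
by rewrite comp1m compm1 hl'.
Qed.

Definition to_truss_hom (X Y : cocycle_module p) (f : cocycle_hom X Y) :
  truss_hom (to_truss X) (to_truss Y) :=
  exist _ _ (to_truss_is_hom f).

Definition truss_functor : functor (cocycle_Mod p) (truss_Mod T).
Proof.
apply: (@Functor (cocycle_Mod p) (truss_Mod T) to_truss to_truss_hom).
- by move=> X; apply: sig_eq.
- by move=> X Y Z g f; apply: sig_eq.
Defined.

(** * From truss modules to cocycle modules *)

Section ToCocycle.
Variable Y : truss_module T.

Local Notation GamY :=
  (Gam (H := H) (hm_antip H) (ct_sigma p) (tm_act1 Y) (tm_act2 Y)).

Definition cocycle_phiM : hom (B ⊗ tm_car Y) (tm_car Y) :=
  GamY ∘ (pi ▷ tm_car Y).

Definition cocycle_phiN : hom (B ⊗ tm_car Y) (tm_car Y) :=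
  tm_act2 Y ∘ (pi ▷ tm_car Y).

Lemma cocycle_phiN_assoc : assoc_action (nb_mul B) cocycle_phiN.
Proof.
have := tm_module2 Y; rewrite /assoc_action /cocycle_phiN /= => actA.
have -> : B ◁ (tm_act2 Y ∘ (pi ▷ tm_car Y))
  = (B ◁ tm_act2 Y) ∘ (B ◁ (pi ▷ tm_car Y)) by rewrite whiskl_comp.
rewrite -!compA (compA (pi ▷ _)) -tensm_split' tensm_split -!compA.
rewrite (compA (pi ▷ _)) -tensm_split' -asso_nat !compA actA.
rewrite -!compA -!tensm_comp !comp1m; congr (_ ∘ (_ ⊠ _)).
(* π is multiplicative from the product of [B] to [ct_mul p]. *)
by rewrite /ct_mul -!compA -tensm_comp !invK tensm_id compm1.
Qed.

(** Convolving the truss compatibility with λ ∘ σ_π changes only the first diagonal factor, from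
    [ct_mul p] to its own Γ, which [ct_Gam] identifies with the transported [phi]. *)
Lemma Gam_compat :
  GamY ∘ (H ◁ tm_act1 Y)
  = diag (D := H) (tm_act1 Y) (phi ∘ (inv pi ▷ H)) GamY.
Proof.
have [actA _] := tm_module1 Y.
rewrite {1}/Gam conv_nat (tm_compat Y) /= -(ct_Gam p).
exact: (conv_diag (comonoidP H) _ (ct_mul p) _ actA).
Qed.

Lemma cocycle_phiM_compat :
  cocycle_phiM ∘ (B ◁ tm_act1 Y) = diag (D := B) (tm_act1 Y) phi cocycle_phiM.
Proof.
rewrite /cocycle_phiM -compA -tensm_split' tensm_split compA Gam_compat.
rewrite (diag_comonoid _ _ _ (gc_pi_comonoid p)).
by rewrite iso_whiskrVK.
Qed.

(** As π ∘ θ = σ_π ∘ π, the morphism π factors out of the convolution; what remains is σ_π convolved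
    with Γ, which gives back [tm_act2 Y]. *)
Lemma cocycle_phiN_cocycle :
  iso_id (tm_car Y) ∘ cocycle_phiN
  = tm_act1 Y ∘ ((pi ∘ gc_theta p) ⊠ cocycle_phiM) ∘ asso B B (tm_car Y)
    ∘ (coprod B ⊠ iso_id (tm_car Y)).
Proof.
rewrite /= comp1m.
transitivity (conv (D := B) (tm_act1 Y) (pi ∘ gc_theta p) cocycle_phiM) => //.
have -> : pi ∘ gc_theta p = ct_sigma p ∘ pi.
  by rewrite /ct_sigma -compA invK compm1.
rewrite -(conv_comonoid _ _ _ (gc_pi_comonoid p)) /cocycle_phiN; congr (_ ∘ _).
symmetry.
exact: conv_antipode_right (hopf_monoidP H) (ct_sigma_comonoid p)
  (tm_module1 Y).
Qed.

Definition to_cocycle : cocycle_module p :=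
  @CocycleModule C B H phi p (tm_car Y) (tm_car Y) cocycle_phiM (tm_act1 Y)
    cocycle_phiN (iso_id (tm_car Y)) (tm_module1 Y) cocycle_phiN_assoc
    cocycle_phiM_compat cocycle_phiN_cocycle.

End ToCocycle.

Lemma to_cocycle_is_hom (X Y : truss_module T) (f : truss_hom X Y) :
  is_cocycle_hom (X := to_cocycle X) (Y := to_cocycle Y)
    (proj1_sig f, proj1_sig f).
Proof.
case: f => [f [f1 f2]]; split=> //=.
- apply: linear_base_change; exact: linear_conv f1 f2.
- exact: linear_base_change.
- by rewrite comp1m compm1.
Qed.

Definition to_cocycle_hom (X Y : truss_module T) (f : truss_hom X Y) :
  cocycle_hom (to_cocycle X) (to_cocycle Y) :=
  exist _ _ (to_cocycle_is_hom f).

Definition cocycle_functor : functor (truss_Mod T) (cocycle_Mod p).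
Proof.
apply: (@Functor (truss_Mod T) (cocycle_Mod p) to_cocycle to_cocycle_hom).
- by move=> X; apply: sig_eq.
- by move=> X Y Z g f; apply: sig_eq.
Defined.

(** * The two round trips and their naturality *)

Lemma cocycle_phiM_to_truss (X : cocycle_module p) :
  cocycle_phiM (to_truss X) = cm_phiM X.
Proof. by rewrite /cocycle_phiM Gam_truss_act2 iso_whiskrVK. Qed.

(** The action on [N] returns conjugated by γ, which is why the comparison morphism has γ⁻¹ as its
    second component. *)
Lemma cocycle_phiN_to_truss (X : cocycle_module p) :
  cocycle_phiN (to_truss X)
  = cm_gamma X ∘ cm_phiN X ∘ (B ◁ inv (cm_gamma X)).
Proof.
rewrite /cocycle_phiN /= /truss_act2 -!compA -tensm_comp.
by rewrite invK compm1.
Qed.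

Lemma cocycle_roundtrip_is_hom (X : cocycle_module p) :
  is_cocycle_hom (X := to_cocycle (to_truss X)) (Y := X)
    (idm (cm_M X), inv (cm_gamma X)).
Proof.
split=> /=.
- rewrite cocycle_phiM_to_truss; exact: linear_id.
- exact: linear_id.
- by rewrite /linear cocycle_phiN_to_truss !compA invK comp1m.
- by rewrite comp1m fwdK.
Qed.

Lemma cocycle_roundtrip_inv_is_hom (X : cocycle_module p) :
  is_cocycle_hom (X := X) (Y := to_cocycle (to_truss X))
    (idm (cm_M X), fwd (cm_gamma X)).
Proof.
split=> /=.
- rewrite cocycle_phiM_to_truss; exact: linear_id.
- exact: linear_id.
- rewrite /linear cocycle_phiN_to_truss -!compA -whiskl_comp invK tensm_id.
  by rewrite compm1.
- by [].
Qed.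

Lemma truss_act2_to_cocycle (Y : truss_module T) :
  truss_act2 (to_cocycle Y) = tm_act2 Y.
Proof. by rewrite /truss_act2 /= comp1m /cocycle_phiN iso_whiskrK. Qed.

Lemma truss_roundtrip_is_hom (Y : truss_module T) :
  linear (tm_act1 (to_truss (to_cocycle Y))) (tm_act1 Y) (idm (tm_car Y))
  /\ linear (tm_act2 (to_truss (to_cocycle Y))) (tm_act2 Y) (idm (tm_car Y)).
Proof.
split; first exact: linear_id.
rewrite /= truss_act2_to_cocycle; exact: linear_id.
Qed.

Lemma truss_roundtrip_inv_is_hom (Y : truss_module T) :
  linear (tm_act1 Y) (tm_act1 (to_truss (to_cocycle Y))) (idm (tm_car Y))
  /\ linear (tm_act2 Y) (tm_act2 (to_truss (to_cocycle Y))) (idm (tm_car Y)).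
Proof.
split; first exact: linear_id.
rewrite /= truss_act2_to_cocycle; exact: linear_id.
Qed.

Lemma cocycle_truss_nat_iso :
  nat_isomorphic (functor_comp cocycle_functor truss_functor)
    (functor_id (cocycle_Mod p)).
Proof.
exists (fun X => exist _ _ (cocycle_roundtrip_is_hom X)); split.
- move=> X; exists (exist _ _ (cocycle_roundtrip_inv_is_hom X)).
  by split; apply: sig_eq; rewrite /= comp1m ?fwdK ?invK.
- move=> X Y f; apply: sig_eq; rewrite /= comp1m.
  case: f => [[h l] [/= _ _ _ hl]]; rewrite compm1; congr pair.
  (* Naturality on [N] is the square [hl] with both copies of γ inverted. *)
  rewrite -[LHS]compm1 -(fwdK (cm_gamma X)) !compA; congr (_ ∘ _).
  by rewrite -compA hl compA invK comp1m.
Qed.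

(** This round trip keeps the object and the first action, and returns an equal second action, so
    identities serve as components. *)
Lemma truss_cocycle_nat_iso :
  nat_isomorphic (functor_comp truss_functor cocycle_functor)
    (functor_id (truss_Mod T)).
Proof.
exists (fun Y => exist _ _ (truss_roundtrip_is_hom Y) : truss_hom _ _); split.
- move=> Y; exists (exist _ _ (truss_roundtrip_inv_is_hom Y) : truss_hom _ _).
  by split; apply: sig_eq; rewrite /= comp1m.
- move=> X Y f; by apply: sig_eq; rewrite /= comp1m compm1.
Qed.

End Equivalence.

Theorem theorem4p13 (C : strict_braided) (B : nubimonoid C) (H : hopf_monoid C)
  (phi : module_monoid_action B H) (p : gen_inv_1cocycle phi) :
  equivalent (cocycle_Mod p) (truss_Mod (cocycle_truss p)).
Proof.
exists (truss_functor p), (cocycle_functor p); split.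
- exact: cocycle_truss_nat_iso.
- exact: truss_cocycle_nat_iso.
Qed.
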